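(* $V_7=\displaystyle\inf_{a\in[1.6456659,\,1.8231801]}\frac{\chi_7(a)}{(\sqrt a-1)^2}$.
   Context: For an integer $n\ge 2$, $C_n$ denotes the set of real cosine polynomials $f(\phi)=\sum_{k=0}^{n} a_k\cos(k\phi)$ such that (i) all coefficients are real and nonnegative, (ii) $a_1>a_0>0$, and (iii) $f(\phi)\ge 0$ for all real $\phi$. For $f\in C_n$, $v(f)=\dfrac{f(0)-a_0}{(\sqrt{a_1}-\sqrt{a_0})^2}$ and $V_n=\inf_{f\in C_n}v(f)$. For $a\in\left(1,2\cos\frac{\pi}{n+2}\right]$, $\chi_n(a)=\inf\{f(0)-1 : f\in C_n,\ a_0(f)=1,\ a_1(f)=a\}$, where $a_k(f)$ is the $k$-th cosine coefficient of $f$. Numerical constants are decimal values as given in the paper, to seven decimal places. *)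

(* Defs.v *)
From Stdlib Require Import Reals.
From Coquelicot Require Import Coquelicot.

Open Scope R_scope.

(* A cosine polynomial of degree at most n is represented by its sequence of
   coefficients, which is determined by the polynomial since the functions
   cos (k phi) are linearly independent. *)
Definition cospoly (n : nat) (a : nat -> R) (phi : R) : R :=
  sum_f_R0 (fun k => a k * cos (INR k * phi)) n.

Definition Cn (n : nat) (a : nat -> R) : Prop :=
  (forall k, (n < k)%nat -> a k = 0) /\
  (forall k, 0 <= a k) /\
  0 < a 0%nat < a 1%nat /\
  (forall phi, 0 <= cospoly n a phi).

Definition v (n : nat) (a : nat -> R) : R :=
  (cospoly n a 0 - a 0%nat) / (sqrt (a 1%nat) - sqrt (a 0%nat)) ^ 2.

Definition V (n : nat) : Rbar :=
  Glb_Rbar (fun y => exists a, Cn n a /\ y = v n a).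

(* The set below is bounded below by 0, and for n >= 2 and
   1 < x <= 2 cos (PI / (n + 2)) it is nonempty: if F is Fejer's nonnegative
   polynomial with F_0 = 1 and F_1 = 2 cos (PI / (n + 2)), it contains the
   value of 1 + (x / F_1) (F - 1).  So [real] loses nothing for such x. *)
Definition chi (n : nat) (x : R) : R :=
  real (Glb_Rbar (fun y => exists a,
    Cn n a /\ a 0%nat = 1 /\ a 1%nat = x /\ y = cospoly n a 0 - 1)).

(* Main.v *)
(* Both infima are compared with the threshold 34.8.  An explicit polynomial
   with a_1 / a_0 inside the interval has v <= 34.8.  Outside the interval
   v >= 34.8 by linear programming duality: with x = cos phi, nonnegativity of
   f at finitely many rational x, combined with suitable weights and the
   nonnegativity of the coefficients, bounds f(0) - a_0 below by a linear
   function of a_0 and a_1; three such linear functions suffice. *)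
Require Import Defs.
From Stdlib Require Import Reals Lra Lia.
From Coquelicot Require Import Coquelicot.

Open Scope R_scope.

(** * Cosine polynomials as polynomials in [cos phi], via Chebyshev polynomials *)

Fixpoint cheb (k : nat) (x : R) : R :=
  match k with
  | 0%nat => 1
  | S k' => match k' with
            | 0%nat => x
            | S k'' => 2 * x * cheb k' x - cheb k'' x
            end
  end.

Lemma cos_INR_mult k phi : cos (INR k * phi) = cheb k (cos phi).
Proof.
enough (H : cos (INR k * phi) = cheb k (cos phi) /\
            cos (INR (S k) * phi) = cheb (S k) (cos phi)) by apply H.
induction k as [|k [IH1 IH2]].
- split; simpl; [now rewrite Rmult_0_l, cos_0 | now rewrite Rmult_1_l].
- split; [exact IH2|].
  change (cheb (S (S k)) (cos phi))
    with (2 * cos phi * cheb (S k) (cos phi) - cheb k (cos phi)).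
  rewrite <- IH1, <- IH2.
  replace (INR (S (S k)) * phi) with (INR (S k) * phi + phi)
    by (rewrite (S_INR (S k)); ring).
  replace (INR k * phi) with (INR (S k) * phi - phi)
    by (rewrite (S_INR k); ring).
  rewrite cos_plus, cos_minus; ring.
Qed.

Lemma cospoly_cheb n a phi :
  cospoly n a phi = sum_f_R0 (fun k => a k * cheb k (cos phi)) n.
Proof.
apply sum_eq; intros k _; now rewrite cos_INR_mult.
Qed.

Lemma Cn_cheb_nonneg n a x :
  Cn n a -> -1 <= x <= 1 -> 0 <= sum_f_R0 (fun k => a k * cheb k x) n.
Proof.
intros (_ & _ & _ & Hf) Hx.
rewrite <- (cos_acos x Hx), <- cospoly_cheb; apply Hf.
Qed.

Lemma cospoly_at_0 n a : cospoly n a 0 = sum_f_R0 a n.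
Proof.
apply sum_eq; intros k _; now rewrite Rmult_0_r, cos_0, Rmult_1_r.
Qed.

Lemma Cn_coef_le_at_0 n a :
  (1 <= n)%nat -> Cn n a -> a 0%nat + a 1%nat <= cospoly n a 0.
Proof.
intros Hn (_ & Ha & _); rewrite cospoly_at_0.
induction Hn as [|n Hn IH]; simpl; [lra | specialize (Ha (S n)); lra].
Qed.

(** * Scaling to [a 0 = 1], and finiteness of [chi] *)

Lemma Cn_scale n a c : 0 < c -> Cn n a -> Cn n (fun k => c * a k).
Proof.
intros Hc (Hz & Ha & H01 & Hf); repeat split.
- intros k Hk; rewrite (Hz k Hk); ring.
- intros k; specialize (Ha k); nra.
- nra.
- nra.
- intros phi; unfold cospoly.
  rewrite (sum_eq _ (fun k => a k * cos (INR k * phi) * c))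
    by (intros; ring).
  rewrite <- scal_sum; specialize (Hf phi); unfold cospoly in Hf; nra.
Qed.

Lemma cospoly_scale n a c phi :
  cospoly n (fun k => c * a k) phi = c * cospoly n a phi.
Proof.
unfold cospoly; rewrite scal_sum; apply sum_eq; intros; ring.
Qed.

Lemma v_scale n a c : 0 < c -> Cn n a -> v n (fun k => c * a k) = v n a.
Proof.
intros Hc (_ & _ & H01 & _); unfold v; rewrite cospoly_scale.
rewrite !sqrt_mult by lra.
assert (sqrt (a 0%nat) < sqrt (a 1%nat)) by (apply sqrt_lt_1; lra).
pose proof (sqrt_lt_R0 c Hc) as Hr.
pose proof (sqrt_sqrt c (Rlt_le _ _ Hc)) as Hrr.
set (r := sqrt c) in *; clearbody r; subst c.
field; split; nra.
Qed.

Lemma real_Glb_Rbar_correct E :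
  (exists y, E y) -> (forall y, E y -> 0 <= y) ->
  is_glb_Rbar E (real (Glb_Rbar E)).
Proof.
intros [y Hy] H0; pose proof (Glb_Rbar_correct E) as [Hlb Hglb].
assert (H0' : Rbar_le 0 (Glb_Rbar E)) by (apply Hglb; exact H0).
specialize (Hlb y Hy) as Hy'.
assert (HE : Finite (real (Glb_Rbar E)) = Glb_Rbar E)
  by (destruct (Glb_Rbar E); simpl in *; easy).
rewrite HE; apply Glb_Rbar_correct.
Qed.

Lemma chi_correct n x :
  (1 <= n)%nat -> (exists a, Cn n a /\ a 0%nat = 1 /\ a 1%nat = x) ->
  is_glb_Rbar (fun y => exists a,
    Cn n a /\ a 0%nat = 1 /\ a 1%nat = x /\ y = cospoly n a 0 - 1) (chi n x).
Proof.
intros Hn (a & Ha & H0 & H1); apply real_Glb_Rbar_correct.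
- exists (cospoly n a 0 - 1), a; auto.
- intros y (b & Hb & Hb0 & _ & ->).
  pose proof (Cn_coef_le_at_0 n b Hn Hb); destruct Hb as (_ & _ & Hb & _); lra.
Qed.

(** * Explicit members of C_7 *)

Definition coefs8 (c0 c1 c2 c3 c4 c5 c6 c7 : R) (k : nat) : R :=
  match k with
  | 0%nat => c0 | 1%nat => c1 | 2%nat => c2 | 3%nat => c3
  | 4%nat => c4 | 5%nat => c5 | 6%nat => c6 | 7%nat => c7 | _ => 0
  end.

Lemma Cn_coefs8 c0 c1 c2 c3 c4 c5 c6 c7 :
  0 < c0 < c1 -> 0 <= c2 -> 0 <= c3 -> 0 <= c4 -> 0 <= c5 -> 0 <= c6 ->
  0 <= c7 ->
  (forall x, -1 <= x <= 1 ->
     0 <= sum_f_R0 (fun k => coefs8 c0 c1 c2 c3 c4 c5 c6 c7 k * cheb k x) 7) ->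
  Cn 7 (coefs8 c0 c1 c2 c3 c4 c5 c6 c7).
Proof.
intros; repeat split; try (simpl; lra).
- intros k Hk; do 8 (destruct k as [|k]; [lia|]); reflexivity.
- intros k; do 8 (destruct k as [|k]; [simpl; lra|]); simpl; lra.
- intros phi; rewrite cospoly_cheb.
  match goal with H : forall x, _ |- _ => apply H end; apply COS_bound.
Qed.

(* A rational approximation of the minimiser of [v 7], with its double zeros
   moved to [cos phi = -3/4, -1/4]. *)
Definition witness := coefs8 4508 7743 4828 2033 464 8 0 16.

Lemma witness_Cn : Cn 7 witness.
Proof.
apply Cn_coefs8; try lra.
intros x Hx; simpl.
match goal with |- 0 <= ?p =>
  replace p with
    (4 * (1 + x) * ((4 * x + 3) * (4 * x + 1)) ^ 2 * (x ^ 2 - 3 * x + 4))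
    by ring
end.
apply Rmult_le_pos; [apply Rmult_le_pos; [lra | apply pow2_ge_0] | nra].
Qed.

Lemma v_witness : v 7 witness <= 34.8.
Proof.
unfold v; rewrite cospoly_at_0; simpl.
(* The product is about 5908.08 and the claim needs at most about 5908.66, so 5909 alone falls just
   short; nonnegativity of the square of [5909 - sqrt 7743 * sqrt 4508] closes the gap. *)
assert (H : sqrt 7743 * sqrt 4508 <= 5909)
  by (rewrite <- sqrt_mult by lra; apply Rsqr_incr_0_var; [|lra];
      rewrite Rsqr_sqrt; unfold Rsqr; lra).
pose proof (sqrt_sqrt 7743 ltac:(lra)); pose proof (sqrt_sqrt 4508 ltac:(lra)).
apply Rle_div_l; nra.
Qed.

(* The coefficients of [|sum_j c_j e^(i j phi)|^2] for
   [c = (1,2,3,3,3,3,2,1)], an integer approximation of Fejer's extremal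
   polynomial; here [a_1 / a_0 = 43 / 23] exceeds 1.8231801. *)
Definition fejer := coefs8 46 86 72 54 36 20 8 2.

Lemma fejer_cheb_nonneg x :
  -1 <= x <= 1 -> 0 <= sum_f_R0 (fun k => fejer k * cheb k x) 7.
Proof.
intros Hx; simpl.
match goal with |- 0 <= ?p =>
  replace p with (2 * (1 + x) * ((2 * x + 1) ^ 2 * (2 * x - 1)) ^ 2) by ring
end.
apply Rmult_le_pos; [lra | apply pow2_ge_0].
Qed.

(** A convex combination of the constant 1 and [fejer] divided by 46 keeps the mean 1 and reaches
    every first coefficient up to 86/46. *)
Lemma C7_nonempty x :
  1 < x <= 43 / 23 -> exists a, Cn 7 a /\ a 0%nat = 1 /\ a 1%nat = x.
Proof.
intros Hx; set (t := x / 86).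
exists (coefs8 1 (t * 86) (t * 72) (t * 54) (t * 36) (t * 20) (t * 8) (t * 2)).
assert (Ht : 0 <= t <= 1 / 46) by (unfold t; lra).
split; [|simpl; unfold t; split; lra].
apply Cn_coefs8; try (unfold t; lra).
intros y Hy; pose proof (fejer_cheb_nonneg y Hy) as H; simpl in *.
match type of H with 0 <= ?p =>
  match goal with |- 0 <= ?q =>
    replace q with (t * p + (1 - 46 * t)) by ring end end.
nra.
Qed.

(** * Linear lower bounds on C_7 by duality *)

Lemma C7_line_low a :
  Cn 7 a -> 2 * a 1%nat - a 0%nat <= cospoly 7 a 0 - a 0%nat.
Proof.
(* At x = -1 the even coefficients sum to at least the odd ones, so f(0) is at least twice the odd
   sum. *)
intros Ha; pose proof (Cn_cheb_nonneg 7 a (-1) Ha ltac:(lra)) as H.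
destruct Ha as (_ & Hp & _); rewrite cospoly_at_0; simpl in *.
pose proof (Hp 3%nat); pose proof (Hp 5%nat); pose proof (Hp 7%nat); lra.
Qed.

(* [lra] finds the dual weights at the evaluation points [pts]. *)
Ltac C7_dual pts :=
  intros a Ha;
  let rec go l := lazymatch l with
    | (?l', ?x) => pose proof (Cn_cheb_nonneg 7 a x Ha ltac:(lra)); go l'
    | ?x => pose proof (Cn_cheb_nonneg 7 a x Ha ltac:(lra))
  end in go pts;
  destruct Ha as (_ & Hp & _); rewrite ?cospoly_at_0; simpl in *;
  pose proof (Hp 0%nat); pose proof (Hp 1%nat);
  pose proof (Hp 2%nat); pose proof (Hp 3%nat); pose proof (Hp 4%nat);
  pose proof (Hp 5%nat); pose proof (Hp 6%nat); pose proof (Hp 7%nat); lra.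

Lemma C7_line_mid : forall a, Cn 7 a ->
  6.55 * a 1%nat - 7.97 * a 0%nat <= cospoly 7 a 0 - a 0%nat.
Proof. C7_dual (-1, -5/6, -2/3, -1/3). Qed.

Lemma C7_line_high : forall a, Cn 7 a ->
  120 / 7 * a 1%nat - 187 / 7 * a 0%nat <= cospoly 7 a 0 - a 0%nat.
Proof. C7_dual (-1, -3/4, -1/4, 0, 1/4). Qed.

(** The sharp constant is 2 cos (PI / 9), about 1.879; any constant below 1.96 = 1.4^2 serves in
    [v_ge_outside]. *)
Lemma C7_coef1_le : forall a, Cn 7 a -> a 1%nat <= 1.95 * a 0%nat.
Proof. C7_dual (-1, -3/4, -1/2, -1/4, 0, 1/4, 1/2, 3/4). Qed.

Lemma v_ge_outside a :
  Cn 7 a -> a 0%nat = 1 -> a 1%nat < 1.6456659 \/ 1.8231801 < a 1%nat ->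
  34.8 <= v 7 a.
Proof.
intros Ha H0 Hout.
pose proof (C7_line_low a Ha) as Hlow.
pose proof (C7_line_mid a Ha) as Hmid.
pose proof (C7_line_high a Ha) as Hhigh.
pose proof (C7_coef1_le a Ha) as Hle.
destruct Ha as (_ & _ & H01 & _).
unfold v; rewrite H0, sqrt_1 in *.
set (x := a 1%nat) in *; clearbody x.
set (y := cospoly 7 a 0 - 1) in *; clearbody y.
pose proof (sqrt_sqrt x ltac:(lra)) as Hs.
assert (H1s : 1 < sqrt x) by (rewrite <- sqrt_1; apply sqrt_lt_1; lra).
set (s := sqrt x) in *; clearbody s; subst x.
assert (0 < (s - 1) ^ 2) by (apply pow_lt; lra).
apply (Rle_div_r 34.8); [assumption|].
(* In s, each line minus 34.8 (s - 1)^2 is a concave quadratic, nonnegative at both ends of its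
   range, hence between them. The low line covers [1, 1.24], the middle one [1.24, 1.2829], the high
   one [1.35, 1.4]. *)
destruct Hout as [Hout | Hout].
- assert (s < 1.2829) by nra.
  destruct (Rle_lt_dec s 1.24).
  + assert (0 <= (s - 1) * (1.24 - s)) by (apply Rmult_le_pos; lra); nra.
  + assert (0 <= (s - 1.24) * (1.2829 - s)) by (apply Rmult_le_pos; lra); nra.
- assert (1.35 < s) by nra.
  assert (s < 1.4) by nra.
  assert (0 <= (s - 1.35) * (1.4 - s)) by (apply Rmult_le_pos; lra); nra.
Qed.

Theorem theorem7p1 :
  V 7 = Glb_Rbar (fun y => exists a : R,
    1.6456659 <= a <= 1.8231801 /\ y = chi 7 a / (sqrt a - 1) ^ 2).
Proof.
symmetry; apply is_glb_Rbar_unique.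
pose proof (Glb_Rbar_correct (fun y => exists a, Cn 7 a /\ y = v 7 a))
  as [Hlb Hglb].
fold (V 7) in Hlb, Hglb.
assert (Hsq : forall x, 1 < x -> 0 < (sqrt x - 1) ^ 2).
{ intros x Hx; assert (1 < sqrt x) by (rewrite <- sqrt_1; apply sqrt_lt_1; lra).
  nra. }
assert (Hv1 : forall a, a 0%nat = 1 ->
  v 7 a = (cospoly 7 a 0 - 1) / (sqrt (a 1%nat) - 1) ^ 2)
  by (intros a H0; unfold v; now rewrite H0, sqrt_1).
assert (Hnorm : forall a, Cn 7 a ->
  exists b, Cn 7 b /\ b 0%nat = 1 /\ b 1%nat = a 1%nat / a 0%nat /\
            v 7 b = v 7 a).
{ intros a Ha; pose proof Ha as (_ & _ & H01 & _).
  assert (0 < / a 0%nat) by (apply Rinv_0_lt_compat; lra).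
  exists (fun k => / a 0%nat * a k); split; [|split; [|split]].
  - now apply Cn_scale.
  - field; lra.
  - field; lra.
  - now apply v_scale. }
assert (Hchi : forall b, Cn 7 b -> b 0%nat = 1 ->
  chi 7 (b 1%nat) / (sqrt (b 1%nat) - 1) ^ 2 <= v 7 b).
{ intros b Hb H0; rewrite (Hv1 b H0).
  assert (1 < b 1%nat) by (destruct Hb as (_ & _ & ? & _); lra).
  apply Rmult_le_compat_r;
    [now apply Rlt_le, Rinv_0_lt_compat, Hsq|].
  apply (proj1 (chi_correct 7 (b 1%nat) ltac:(lia)
    (ex_intro _ b (conj Hb (conj H0 eq_refl))))).
  now exists b. }
split.
- intros y (x & Hx & ->).
  specialize (Hsq x ltac:(lra)).
  destruct (chi_correct 7 x ltac:(lia) (C7_nonempty x ltac:(lra)))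
    as [_ Hchi_glb].
  destruct (V 7) as [l| |]; 
    [| exact (False_ind _ (Hlb _ (ex_intro _ _ (conj witness_Cn eq_refl))))
     | exact I].
  (* It remains to see that [l * (sqrt x - 1) ^ 2] is a lower bound of the set whose infimum is
     [chi 7 x]. *)
  simpl; apply Rle_div_r; [exact Hsq|].
  apply (Hchi_glb (Finite _)).
  intros z (a & Ha & H0 & H1 & ->); simpl.
  pose proof (Hlb _ (ex_intro _ a (conj Ha eq_refl))) as H; simpl in H.
  rewrite (Hv1 a H0), H1 in H.
  now apply Rle_div_r in H.
- intros m Hm; apply Hglb; intros y (a & Ha & ->).
  destruct (Hnorm a Ha) as (b & Hb & H0 & _ & <-).
  destruct (Rlt_le_dec (b 1%nat) 1.6456659) as [Hlo | Hlo];
    [| destruct (Rle_lt_dec (b 1%nat) 1.8231801) as [Hhi | Hhi]].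
  2: { eapply Rbar_le_trans; [apply Hm; exists (b 1%nat); now split|].
       now apply Hchi. }
  (* Outside the interval, m is compared through the normalised witness, whose ratio 7743/4508 is
     about 1.7176: m <= v w <= 34.8 <= v b. *)
  all: destruct (Hnorm witness witness_Cn) as (w & Hw & Hw0 & Hw1 & Hwv);
    eapply Rbar_le_trans;
    [apply Hm; exists (w 1%nat); split;
       [rewrite Hw1; unfold witness; simpl; lra | reflexivity]|];
    apply Rle_trans with (v 7 w); [now apply Hchi|];
    rewrite Hwv; apply Rle_trans with (1 := v_witness);
    apply v_ge_outside; auto.
Qed.
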